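(* Consider the weakest user (user 1) of the $K$-user cooperative NOMA system, $K\ge2$, with signal-to-noise ratio $$\gamma_1=\rho|h_1|^2p_1^2+\rho\sum_{i=1}^{K-1}|g_{K-i+1,1}|^2q_{K-i+1,1}^2,$$ where $\rho>0$, $p_1>0$ and $q_{j,1}>0$ for $2\le j\le K$. Set $\lambda_0=\frac{\rho p_1^2}{K}$ and $\lambda_i=\rho q_{K-i+1,1}^2$ for $1\le i\le K-1$, and assume that $\lambda_0,\dots,\lambda_{K-1}$ are pairwise distinct. Then for every threshold $\phi_1\ge0$ the outage probability of the weakest user is $$\Pr(\gamma_1\le\phi_1)=\sum_{i=0}^{K-1}C_i\left(1-e^{-\frac{\phi_1}{\lambda_i}}\right),\qquad C_i=\prod_{\substack{0\le j\le K-1\\ j\ne i}}\frac{\frac1{\lambda_j}}{\frac1{\lambda_j}-\frac1{\lambda_i}}.$$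
   Context: Channel model: $|h_1|^2$ is the minimum of $K$ independent exponential random variables of mean $1$ (the base-station-to-user channel power gains). For $2\le j\le K$, $|g_{j,1}|^2$ is the channel power gain from user $j$ to user $1$; these are independent exponential random variables of mean $1$, independent of $|h_1|^2$. The numbers $p_1$ and $q_{j,1}$ are the power allocation coefficients of user 1's message at the base station and at user $j$, respectively; the noise has unit variance. *)

(* Defs.v *)
From HB Require Import structures.
From mathcomp Require Import all_boot all_order all_algebra finmap.
From mathcomp Require Import all_classical all_reals all_analysis.

Set Implicit Arguments.
Unset Strict Implicit.
Unset Printing Implicit Defensive.
Import Order.TTheory GRing.Theory Num.Theory.
Import numFieldNormedType.Exports.

Local Open Scope classical_set_scope.
Local Open Scope ring_scope.

(* [exponential_prob] takes the rate, i.e. the inverse of the mean. *)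
Definition exponential_rv (d : measure_display) (T : measurableType d)
    (R : realType) (P : probability T R) (mean : R) (X : {RV P >-> R}) : Prop :=
  forall A : set R, measurable A ->
    distribution P X A = exponential_prob mean^-1 A.

Definition mutually_independent (d : measure_display) (T : measurableType d)
    (R : realType) (P : probability T R) (I : choiceType) (D : set I)
    (X : I -> {RV P >-> R}) : Prop :=
  forall (J : {fset I}) (A : I -> set R),
    [set` J] `<=` D -> (forall i, measurable (A i)) ->
    P (\bigcap_(i in [set` J]) (X i @^-1` A i)) =
    (\prod_(i <- J) P (X i @^-1` A i))%E.

(* [X] is independent of the whole subfamily of [Y] indexed by [D], that is, of
   every event of the sigma-algebra generated by that subfamily; this is
   stronger than independence of [X] from each [Y i]. *)
Definition independent_of_family (d : measure_display) (T : measurableType d)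
    (R : realType) (P : probability T R) (I : choiceType)
    (X : {RV P >-> R}) (D : set I) (Y : I -> {RV P >-> R}) : Prop :=
  forall (A : set R) (B : set T), measurable A ->
    <<s \bigcup_(i in D)
          [set Y i @^-1` C | C in [set C : set R | measurable C]] >> B ->
    P (X @^-1` A `&` B) = (P (X @^-1` A) * P B)%E.

(* [h1] and [g j] are power gains, i.e. they stand for |h_1|^2 and
   |g_{j,1}|^2; [q j] stands for q_{j,1}. Users are numbered 1, ..., K, and
   only [g j] and [q j] with 2 <= j <= K are used. *)
Definition weakest_snr (R : realType) (T : Type) (K : nat) (rho p1 : R)
    (q : nat -> R) (h1 : T -> R) (g : nat -> T -> R) (x : T) : R :=
  rho * h1 x * p1 ^+ 2 +
  rho * \sum_(1 <= i < K) g (K - i + 1)%N x * q (K - i + 1)%N ^+ 2.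

Definition lambda (R : realType) (K : nat) (rho p1 : R) (q : nat -> R)
    (i : nat) : R :=
  if i == 0%N then rho * p1 ^+ 2 / K%:R else rho * q (K - i + 1)%N ^+ 2.

Definition outage_coef (R : realType) (K : nat) (lam : nat -> R) (i : nat) : R :=
  \prod_(0 <= j < K | j != i) ((lam j)^-1 / ((lam j)^-1 - (lam i)^-1)).

(* Main.v *)
Require Import Defs.
From HB Require Import structures.
From mathcomp Require Import all_boot all_order all_algebra finmap.
From mathcomp Require Import all_classical all_reals all_analysis.
From mathcomp Require Import unstable measurable_realfun zify ring lra.

Set Implicit Arguments.
Unset Strict Implicit.
Unset Printing Implicit Defensive.
Import Order.TTheory GRing.Theory Num.Theory.
Import numFieldNormedType.Exports.

Local Open Scope classical_set_scope.
Local Open Scope ring_scope.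

(* The minimum of K independent unit exponentials is exponential of mean 1/K,
   and scaling preserves exponential laws, so gamma_1 is a sum of independent
   exponentials X_0, ..., X_{K-1} of means lambda_i. The distribution function
   of such a sum is found by induction on the number of terms: adding X_n
   convolves it with an exponential density, and an explicit antiderivative
   shows that the coefficient of 1 - exp(-t / lambda_n) created by this is the
   left-hand side of the partial fraction identity
     sum_i C_i a_i / (a_i - b) = prod_j a_j / (a_j - b),  a_i = 1 / lambda_i,
   at b = a_n, that is, the new C_n. *)

(** * Partial fractions for the coefficients C_i *)

Lemma outage_coef_recr (R : realType) (n : nat) (lam : nat -> R) (i : nat) :
  (i < n)%N ->
  outage_coef n.+1 lam i =
  outage_coef n lam i * ((lam n)^-1 / ((lam n)^-1 - (lam i)^-1)).
Proof.
move=> ltin; rewrite /outage_coef big_mkcond big_nat_recr//= -big_mkcond/=.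
by rewrite ifT// gtn_eqF.
Qed.

Lemma outage_coef_last (R : realType) (n : nat) (lam : nat -> R) :
  outage_coef n.+1 lam n =
  \prod_(0 <= j < n) ((lam j)^-1 / ((lam j)^-1 - (lam n)^-1)).
Proof.
rewrite /outage_coef big_mkcond big_nat_recr//= eqxx mulr1.
by apply: eq_big_nat => j /andP[_ ltjn]; rewrite ltn_eqF.
Qed.

(** Induction on [n], using the induction hypothesis both at [b] and at the newly added 1 / lambda.
    Matching the factors of each C_i then leaves, with x and y the old and new inverses, y/(y-x) *
    x/(x-b) + x/(x-y) * y/(y-b) = x/(x-b) * y/(y-b). The induction starts at one term: an empty sum
    is 0 but an empty product is 1. *)
Lemma outage_coef_partial_fractions (R : realType) (n : nat) (lam : nat -> R)
    (b : R) :
  (0 < n)%N ->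
  (forall i j, (i < n)%N -> (j < n)%N -> i != j -> lam i != lam j) ->
  (forall i, (i < n)%N -> (lam i)^-1 != b) ->
  \sum_(0 <= i < n) outage_coef n lam i * ((lam i)^-1 / ((lam i)^-1 - b)) =
  \prod_(0 <= j < n) ((lam j)^-1 / ((lam j)^-1 - b)).
Proof.
elim: n b => // -[_ b _ _ _ |n IHn b _ laminj lamb].
  by rewrite !big_nat1 /outage_coef big_mkcond big_nat1 mul1r.
have IH c : (forall i, (i < n.+1)%N -> (lam i)^-1 != c) -> _ :=
  IHn c isT (fun i j lti ltj => laminj i j (ltnW lti) (ltnW ltj)).
have laminv i : (i < n.+1)%N -> (lam i)^-1 != (lam n.+1)^-1.
  move=> ltin; rewrite (inj_eq invr_inj) laminj//; first exact: ltnW.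
  by rewrite ltn_eqF.
rewrite [RHS]big_nat_recr//= -IH; last by move=> i /ltnW; exact: lamb.
rewrite big_nat_recr//= outage_coef_last -IH//.
rewrite !mulr_suml -big_split/=; apply: eq_big_nat => i /andP[_ ltin].
rewrite outage_coef_recr//.
have := laminv _ ltin; have := lamb _ (ltnW ltin); have := lamb _ (ltnSn n.+1).
set x := (lam i)^-1; set y := (lam n.+1)^-1 => yb xb xy.
by field; rewrite !subr_eq0 yb xb xy eq_sym xy.
Qed.

(** * Convolution with an exponential density, computed by an antiderivative *)

Lemma is_derive_sum_expR (R : realType) (n : nat) (u v p q : nat -> R) (x : R) :
  is_derive x 1
    (fun y => \sum_(0 <= i < n)
       (u i * expR (p i * y) + v i * expR (q i * y)) : R)
    (\sum_(0 <= i < n)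
       (u i * p i * expR (p i * x) + v i * q i * expR (q i * x))).
Proof.
have dexp (c : R) : is_derive x 1 (fun y => expR (c * y)) (c * expR (c * x)).
  have dc : is_derive x 1 (fun y : R => c * y) c.
    rewrite -[X in is_derive _ _ _ X]mulr1.
    exact: (is_deriveZ c (is_derive_id x (1 : R))).
  by rewrite mulrC; exact: (is_derive1_comp (is_derive_expR (c * x)) dc).
elim: n => [|n IHn].
  under eq_fun do rewrite big_geq//.
  by rewrite big_geq//; exact: is_derive_cst.
rewrite big_nat_recr//=; under eq_fun do rewrite big_nat_recr//=.
apply: is_deriveD; apply: is_deriveD; rewrite -mulrA.
  exact: is_deriveZ.
exact: is_deriveZ.
Qed.

Lemma integral_hypoexponential_step (R : realType) (n : nat) (lam : nat -> R)
    (t : R) :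
  (0 < n)%N -> 0 <= t ->
  (forall i j, (i < n.+1)%N -> (j < n.+1)%N -> i != j -> lam i != lam j) ->
  (\int[lebesgue_measure]_(y in `[0%R, t])
     ((\sum_(0 <= i < n)
         outage_coef n lam i * (1 - expR (- ((t - y) / lam i)))) *
      exponential_pdf (lam n)^-1 y)%:E)%E =
  (\sum_(0 <= i < n.+1)
     outage_coef n.+1 lam i * (1 - expR (- (t / lam i))))%:E.
Proof.
move=> n0 t0 laminj.
(* The fundamental theorem below is applied on a nondegenerate interval, so [t = 0] is settled
   first. *)
have [t0'|] := eqVneq t 0.
  rewrite t0' set_itv1 integral_set1 big1// => i _.
  by rewrite mul0r oppr0 expR0 subrr mulr0.
move=> tneq0; have {tneq0}t0 : 0 < t by rewrite lt_neqAle eq_sym tneq0.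
set b := (lam n)^-1.
pose a i := (lam i)^-1.
pose C := outage_coef n lam.
have ab i : (i < n)%N -> a i != b.
  move=> ltin; rewrite (inj_eq invr_inj) laminj// ?ltn_eqF//.
  exact: ltnW.
(* [f] is the integrand expanded into exponentials in [y]. [F] integrates it termwise, dividing by
   [- b] and by [a i - b]; the latter is nonzero since the means are distinct. *)
pose f (y : R) : R := \sum_(0 <= i < n) (C i * b * expR (- b * y)
  + - (C i * b * expR (- (a i * t))) * expR ((a i - b) * y)).
pose F (y : R) : R := \sum_(0 <= i < n) (- C i * expR (- b * y)
  + - (C i * b / (a i - b) * expR (- (a i * t))) * expR ((a i - b) * y)).
have dF (x : R) : is_derive x 1 F (f x).
  have := is_derive_sum_expR n (fun i => - C i)
    (fun i => - (C i * b / (a i - b) * expR (- (a i * t)))) (fun=> - b)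
    (fun i => a i - b) x.
  congr is_derive; apply: eq_big_nat => i /andP[_ ltin]; congr (_ * _ + _ * _).
    by rewrite mulrNN.
  have := ab _ ltin; rewrite -subr_eq0 => ?.
  by field.
(* [f] has the same two-exponential shape as [F], so the same derivative rule yields its
   continuity. *)
have cf : {within `[0, t], continuous f}.
  apply: derivable_within_continuous => x _.
  by have [] := is_derive_sum_expR n (fun i => C i * b)
    (fun i => - (C i * b * expR (- (a i * t)))) (fun=> - b)
    (fun i => a i - b) x.
have cF (x : R) : {for x, continuous F}.
  by apply: differentiable_continuous; apply/derivable1_diffP; have [] := dF x.
transitivity (\int[lebesgue_measure]_(y in `[0%R, t]) (f y)%:E)%E.
  apply: eq_integral => y; rewrite inE/= in_itv/= => /andP[y0 _].
  rewrite exponential_pdfE// mulr_suml; congr EFin; apply: eq_bigr => i _.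
  rewrite (_ : - ((t - y) / lam i) = - (a i * t) + a i * y); last first.
    by rewrite /a; ring.
  rewrite (_ : (a i - b) * y = a i * y + - b * y); last by ring.
  by rewrite !expRD /C; ring.
rewrite (@continuous_FTC2 _ f F 0 t)//; last 2 first.
- split.
  + by move=> x _; have [] := dF x.
  + by apply: cvg_at_right_filter; exact: cF.
  + by apply: cvg_at_left_filter; exact: cF.
- by move=> x _; rewrite derive1E; have [] := dF x.
rewrite -EFinB; congr EFin.
rewrite big_nat_recr//= outage_coef_last.
(* Partial fractions at [b] spread the new last coefficient over the indices [i < n], so the two
   sides can be compared term by term. *)
rewrite -outage_coef_partial_fractions//; last first.
  by move=> i j lti ltj; apply: laminj; exact: ltnW.
rewrite mulr_suml -sumrB -big_split/=; apply: eq_big_nat => i /andP[_ ltin].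
rewrite outage_coef_recr// -/b -/(a i).
have := ab _ ltin; rewrite -subr_eq0 => abi.
rewrite !mulr0 expR0 (_ : (a i - b) * t = a i * t + - (b * t)); last by ring.
rewrite (mulNr b) expRD.
rewrite (mulrC t b) (mulrC t (a i)) -/(C i).
(* The relation [ea * eNa = 1] is the only fact about exponentials still required; afterwards they
   are atoms for [field]. *)
have := expRxMexpNx_1 (a i * t).
set ea := expR (a i * t); set eNa := expR (- (a i * t)) => e1.
set eb := expR (- (b * t)).
have -> : - (C i * b / (a i - b) * eNa) * (ea * eb) =
          - (C i * b / (a i - b)) * eb * (ea * eNa) by ring.
rewrite e1; field.
by rewrite abi -opprB oppr_eq0.
Qed.

(* [exponential_prob] is a measure on [measurableTypeR R], whose canonical
   structure does not unify with that of [R] although both have the same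
   measurable sets. *)
Definition to_measurableTypeR (d : measure_display) (T : measurableType d)
    (R : realType) (X : {mfun T >-> R}) : {mfun T >-> measurableTypeR R} :=
  @mfun_Sub _ _ T (measurableTypeR R) X (mem_set (measurable_funPT X)).

(** * Exponential laws through tails, and laws of pairs *)

Lemma law_eq_survival (R : realType)
    (mu nu : probability (measurableTypeR R) R) :
  (forall t, mu `]t, +oo[%classic = nu `]t, +oo[%classic) ->
  forall A, measurable A -> mu A = nu A.
Proof.
(* Open right half-lines generate the Borel sets and are stable under intersection; those starting
   at -n exhaust the line with finite mass. *)
move=> eqt; apply: (@measure_unique _ _ _
  [set A : set (measurableTypeR R) | exists x, A = `]x, +oo[%classic]
  (fun n => `](- n%:R), +oo[%classic)).
- exact: RGenOInfty.measurableE.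
- move=> _ _ [x ->] [y ->]; exists (Num.max x y).
  apply/seteqP; split => z /=; rewrite !in_itv/= !andbT gt_max.
    by move=> [-> ->].
  by move/andP.
- by move=> n; exists (- n%:R).
- apply/seteqP; split => // x _; exists (Num.bound x) => //=.
  by rewrite in_itv/= andbT ltrNl ltrNbound.
- by move=> _ [x ->]; exact: eqt.
- by move=> n; rewrite (le_lt_trans (probability_le1 _ _)) ?ltry.
Qed.

Lemma exponential_prob_itvoy (R : realType) (r t : R) : 0 < r ->
  exponential_prob r `]t, +oo[%classic = (expR (- (r * Num.max 0 t)))%:E.
Proof.
move=> r0.
unshelve epose (nu := [the probability (measurableTypeR R) R
  of exponential_prob r]); first exact: r0.
have nuN : nu `]-oo, 0[%classic = 0%E.
  rewrite /= /exponential_prob integral0_eq// => x.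
  by rewrite /= in_itv/= => x0; rewrite lt0_exponential_pdf.
have -> : exponential_prob r `]t, +oo[%classic = (1 - nu `]-oo, t]%classic)%E.
  by rewrite -probability_setC//= setCitvl.
have [t0|t0] := ltP t 0.
  rewrite mulr0 oppr0 expR0 (_ : nu _ = 0%E) ?sube0//.
  apply/eqP; rewrite -measure_le0 -[leRHS]nuN le_measure ?inE//.
  by apply: subset_itvl; rewrite bnd_simp.
have -> : nu `]-oo, t]%classic = (1 - (expR (- (r * t)))%:E)%E.
  have -> : `]-oo, t]%classic = `]-oo, 0[%classic `|` `[0, t]%classic :> set R.
    by rewrite -itv_bndbnd_setU.
  rewrite measureU//=; last first.
    by apply/seteqP; split => // x /=; rewrite !in_itv/= => -[]; lra.
  rewrite [X in (X + _)%E]nuN add0e.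
  move: t0; rewrite le_eqVlt => /predU1P[<-|t0].
    by rewrite set_itv1 /exponential_prob integral_set1 mulr0 oppr0 expR0 subee.
  by rewrite exponential_prob_itv0c// mulNr.
by rewrite -!EFinB opprB addrC subrK.
Qed.

(** Tails suit the two operations needed later: scaling only moves the threshold, and a minimum
    exceeds [t] exactly when every term does. The [Num.max] gives tail 1 at negative thresholds. *)
Lemma exponential_rvP (d : measure_display) (T : measurableType d)
    (R : realType) (P : probability T R) (mean : R) (X : {RV P >-> R}) :
  0 < mean ->
  exponential_rv mean X <->
  forall t, P [set x | t < X x] = (expR (- (mean^-1 * Num.max 0 t)))%:E.
Proof.
move=> mean0.
have itvE t : X @^-1` `]t, +oo[%classic = [set x | t < X x].
  by apply/seteqP; split => x /=; rewrite in_itv/= andbT.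
have r0 : 0 < mean^-1 by rewrite invr_gt0.
split=> [Xexp t|Xsurv A mA].
  rewrite -exponential_prob_itvoy//.
  by rewrite -Xexp//= /distribution /pushforward itvE.
unshelve epose (nu := [the probability (measurableTypeR R) R
  of exponential_prob mean^-1]); first exact: r0.
apply: (@law_eq_survival R (distribution P (to_measurableTypeR X)) nu) => //.
move=> t; rewrite [RHS](exponential_prob_itvoy _ r0) -Xsurv -itvE.
by [].
Qed.

(* [B] stands for an event of the variables not yet summed: keeping it in the
   statement propagates their independence from the partial sum. *)
Lemma pair_law (d d1 d2 : measure_display) (T : measurableType d)
    (T1 : measurableType d1) (T2 : measurableType d2)
    (R : realType) (P : probability T R) (X : {mfun T >-> T1})
    (Y : {mfun T >-> T2}) (B : set T) :
  measurable B ->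
  (forall A C, measurable A -> measurable C ->
    P (X @^-1` A `&` (Y @^-1` C `&` B)) =
    (P (X @^-1` A) * (P (Y @^-1` C) * P B))%E) ->
  forall E, measurable E ->
    P ((fun x => (X x, Y x)) @^-1` E `&` B) =
    ((distribution P X \x distribution P Y) E * P B)%E.
Proof.
move=> mB XYB E mE.
pose Z x := (X x, Y x).
have mZ : measurable_fun setT Z by exact: measurable_fun_pair.
(* Both sides vanish when [B] is null. Otherwise [m'] below is the law of the pair conditioned on
   [B]; it agrees with the product law on rectangles, hence everywhere. *)
have [PB0|PB0] := eqVneq (P B) 0%E.
  rewrite PB0 mule0; apply/eqP; rewrite -measure_le0 -PB0.
  apply: le_measure; rewrite ?inE//.
  by apply: measurableI => //; rewrite -[X in measurable X]setTI; exact: mZ.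
have PBfin : P B \is a fin_num by exact: fin_num_measure.
have pB : 0 < fine (P B).
  by rewrite -lte_fin fineK// lt0e PB0 measure_ge0.
have pBV : 0 <= (fine (P B))^-1 by rewrite invr_ge0 ltW.
unshelve epose (pf := [the measure _ _ of pushforward (mrestr P mB) Z]);
  first exact: mZ.
pose m' := mscale (NngNum pBV) pf.
have PBV : ((fine (P B))^-1%:E * P B = 1)%E.
  by rewrite -[X in (_ * X)%E](fineK PBfin) -EFinM mulVf// gt_eqF.
rewrite (product_measure_unique (m' := m'))//=.
  rewrite /m' /mscale/= /pushforward /mrestr/=.
  by rewrite muleAC PBV mul1e.
move=> A C mA mC.
rewrite /m' /mscale/= /pushforward /mrestr/=.
rewrite (_ : _ `&` B = X @^-1` A `&` (Y @^-1` C `&` B)); last first.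
  by rewrite setIA; congr (_ `&` B).
by rewrite XYB// !muleA muleC !muleA (muleC (P B)) PBV mul1e.
Qed.

(** * Adding an independent exponential variable *)

Lemma probability_le_add_exponential (d : measure_display)
    (T : measurableType d) (R : realType) (P : probability T R)
    (S Y : {RV P >-> R}) (F : R -> R) (mean t : R) :
  0 < mean -> exponential_rv mean Y ->
  (forall A C, measurable A -> measurable C ->
    P (S @^-1` A `&` Y @^-1` C) = (P (S @^-1` A) * P (Y @^-1` C))%E) ->
  (forall u, P [set x | S x <= u] = (F u)%:E) ->
  (forall u, u < 0 -> F u = 0) ->
  P [set x | S x + Y x <= t] =
  (\int[lebesgue_measure]_(y in `[0%R, t])
     (F (t - y) * exponential_pdf mean^-1 y)%:E)%E.
Proof.
move=> mean0 Yexp SY SF F0.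
have r0 : 0 < mean^-1 by rewrite invr_gt0.
pose Y' := to_measurableTypeR Y.
pose E := [set z : R * measurableTypeR R | z.1 + (z.2 : R) <= t].
have mE : measurable E.
  rewrite (_ : E = (fun z : R * measurableTypeR R => z.1 + (z.2 : R)) @^-1`
    `]-oo, t]%classic).
    rewrite -[X in measurable X]setTI.
    apply: (_ : measurable_fun setT _) => //.
    apply: measurable_funD; first exact: measurable_fst.
    exact: (@measurable_snd _ _ R (measurableTypeR R)).
  by apply/seteqP; split => z /=; rewrite in_itv.
have -> : P [set x | S x + Y x <= t] =
    (distribution P S \x distribution P Y')%E E.
  have := @pair_law _ _ _ T R (measurableTypeR R) R P S Y' setT measurableT.
  move=> /(_ _ E mE); rewrite setIT probability_setT mule1 => <- //.
  by move=> A C mA mC; rewrite setIT mule1 -SY.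
have xE s y : (y \in xsection E s) = ((s, y) \in E).
  by rewrite /xsection; apply/idP/idP; rewrite !inE/= inE.
(* The law of [Y] is replaced by its density times the indicator of [E], so that Tonelli can
   exchange the order and integrate over the values of [S] first. *)
transitivity (\int[distribution P S]_s \int[lebesgue_measure]_y
  ((\1_E (s, y) * exponential_pdf mean^-1 y)%:E : \bar R))%E.
  apply: eq_integral => s _ /=.
  transitivity (exponential_prob mean^-1 (xsection E s)).
    apply: Yexp.
    exact: (@measurable_xsection _ _ R (measurableTypeR R)).
  rewrite /exponential_prob integral_mkcond; apply: eq_integral => y _.
  rewrite patchE xE indicE.
  by case: ((s, y) \in E); rewrite ?mul1r ?mul0r.
rewrite (@fubini_tonelli _ _ R (measurableTypeR R) R (distribution P S)
  lebesgue_measure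
  (fun z => (\1_E z * exponential_pdf mean^-1 z.2)%:E)); last 2 first.
- apply/measurable_EFinP/measurable_funM => //.
  apply: (@measurableT_comp _ _ _ _ (measurableTypeR R) _
    (exponential_pdf mean^-1)).
    exact: measurable_exponential_pdf.
  exact: measurable_snd.
- by move=> z; rewrite lee_fin mulr_ge0// exponential_pdf_ge0// ltW.
rewrite [RHS]integral_mkcond; apply: eq_integral => y _ /=.
transitivity ((exponential_pdf mean^-1 y)%:E * P [set x | (S x <= t - y)%R])%E.
  have E_y s : \1_E (s, y) = \1_`]-oo, t - y]%classic s :> R.
    rewrite !indicE; congr (nat_of_bool _)%:R.
    by apply/idP/idP; rewrite !inE/= in_itv/= lerBrDr.
  under eq_integral do rewrite EFinM muleC E_y.
  rewrite ge0_integralZl//=.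
  - rewrite integral_indic// setIT /distribution/= /pushforward.
    by congr (_ * P _)%E; apply/seteqP; split => x /=; rewrite in_itv.
  - exact/measurable_EFinP/measurable_indic.
  - by rewrite lee_fin exponential_pdf_ge0// ltW.
rewrite SF -EFinM mulrC patchE.
(* Outside [[0, t]] the integrand vanishes: the density for [y < 0], and [F (t - y)] for [y > t]. *)
case: ifPn => // /negP; rewrite inE/= in_itv/= => /negP.
rewrite negb_and -!ltNge => /orP[y0|ty].
  by rewrite lt0_exponential_pdf// mulr0.
by rewrite F0 ?mul0r// subr_lt0.
Qed.

(** * Independence of partial sums from later terms *)

Section independent_partial_sums.
Context d (T : measurableType d) (R : realType) (P : probability T R).
Context (X : nat -> {mfun T >-> R}) (n : nat).
Context (X_indep : forall A : nat -> set R, (forall i, measurable (A i)) ->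
  P (\big[setI/setT]_(0 <= i < n) (X i @^-1` A i)) =
  (\prod_(0 <= i < n) P (X i @^-1` A i))%E).

Let S m : {mfun T >-> R} := \sum_(0 <= i < m) X i.

Let SE m x : S m x = \sum_(0 <= i < m) X i x.
Proof. by rewrite /S mfun_sum. Qed.

Let SS m x : S m.+1 x = S m x + X m x.
Proof. by rewrite !SE big_nat_recr. Qed.

Let mX i A : measurable A -> measurable (X i @^-1` A).
Proof. by move=> mA; exact: measurable_funPTI. Qed.

Let later m A := \big[setI/setT]_(m <= i < n) (X i @^-1` A i).

Let measurable_later m A :
  (forall i, measurable (A i)) -> measurable (later m A).
Proof. by move=> mA; apply: bigsetI_measurable => i _; exact: mX. Qed.

(** Induction on [m]: the hypothesis at [m] makes [S m], [X m] and the later event independent, so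
    [pair_law] allows [X m] to be absorbed into the sum while the later event stays a separate
    factor. *)
Lemma partial_sum_indep m A D : (m <= n)%N ->
  (forall i, measurable (A i)) -> measurable D ->
  P (S m @^-1` D `&` later m A) =
  (P (S m @^-1` D) * \prod_(m <= i < n) P (X i @^-1` A i))%E.
Proof.
elim: m A D => [|m IHm] A D lemn mA mD.
  have S0 x : S 0 x = 0 by rewrite SE big_geq.
  have [D0|D0] := pselect (D 0).
    rewrite (_ : _ @^-1` D = setT); last first.
      by apply/seteqP; split => // x _ /=; rewrite S0.
    by rewrite setTI probability_setT mul1e X_indep.
  rewrite (_ : _ @^-1` D = set0); last first.
    by apply/seteqP; split => // x /=; rewrite S0.
  by rewrite set0I measure0 mul0e.
have IHX A' D' C :
    (forall i, measurable (A' i)) -> measurable D' -> measurable C ->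
    P (S m @^-1` D' `&` (X m @^-1` C `&` later m.+1 A')) =
    (P (S m @^-1` D') *
     (P (X m @^-1` C) * \prod_(m.+1 <= i < n) P (X i @^-1` A' i)))%E.
  (* Putting [C] at index [m] turns the condition on [X m] and the later event into a single event
     of the form [later m]. *)
  move=> mA' mD' mC; pose A'' i := if i == m then C else A' i.
  have A''E i : (m < i < n)%N -> A'' i = A' i.
    by rewrite /A'' => /andP[ltmi _]; rewrite gtn_eqF.
  have := IHm A'' D' (ltnW lemn) _ mD'.
  rewrite /later !(big_ltn lemn) {2 4}/A'' eqxx.
  rewrite (eq_big_nat _ _ (F2 := fun i => X i @^-1` A' i)); last first.
    by move=> i /A''E ->.
  rewrite (eq_big_nat _ _ (F2 := fun i => P (X i @^-1` A' i))); last first.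
    by move=> i /A''E ->.
  by apply => i; rewrite /A''; case: ifP.
have Plater A' : (forall i, measurable (A' i)) ->
    P (later m.+1 A') = (\prod_(m.+1 <= i < n) P (X i @^-1` A' i))%E.
  move=> mA'; have := IHX A' setT setT mA' measurableT measurableT.
  by rewrite !preimage_setT !setTI probability_setT !mul1e.
have PSX A' : (forall i, measurable (A' i)) ->
    P (S m.+1 @^-1` D `&` later m.+1 A') =
    ((distribution P (S m) \x distribution P (X m))
      [set z | D (z.1 + z.2)%R] * P (later m.+1 A'))%E.
  move=> mA'; rewrite -pair_law//.
  - by congr (P (_ `&` _)); apply/seteqP; split => x /=; rewrite SS.
  - exact: measurable_later.
  - by move=> D' C mD' mC; rewrite IHX// Plater.
  - rewrite -[X in measurable X]setTI.
    have : measurable_fun setT (fun z : R * R => z.1 + z.2).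
      by apply: measurable_funD; [exact: measurable_fst|exact: measurable_snd].
    exact.
(* The trivial later event identifies the product-law factor in [PSX] as the probability that
   [S m.+1] lies in [D]. *)
have laterT : later m.+1 (fun=> setT) = setT.
  by rewrite /later big1// => i _; rewrite preimage_setT.
have := PSX (fun=> setT) (fun=> measurableT).
by rewrite laterT setIT probability_setT mule1 PSX// -Plater// => <-.
Qed.

Lemma partial_sum_indep_next m A C :
  (m < n)%N -> measurable A -> measurable C ->
  P (S m @^-1` A `&` X m @^-1` C) = (P (S m @^-1` A) * P (X m @^-1` C))%E.
Proof.
move=> ltmn mA mC; pose A' i := if i == m then C else setT.
have mA' i : measurable (A' i) by rewrite /A'; case: ifP.
have A'E i : (m.+1 <= i < n)%N -> A' i = setT.
  by rewrite /A' => /andP[ltmi _]; rewrite gtn_eqF.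
have := partial_sum_indep (ltnW ltmn) mA' mA.
rewrite /later !(big_ltn ltmn) {1 3}/A' eqxx.
rewrite big_nat_cond big1 => [|i]; last first.
  by rewrite andbT => /A'E ->; rewrite preimage_setT.
rewrite setIT big_nat_cond big1 ?mule1// => i.
by rewrite andbT => /A'E ->; rewrite preimage_setT probability_setT.
Qed.

End independent_partial_sums.

(** * Distribution function of a sum of independent exponentials *)

Theorem sum_exponential_cdf d (T : measurableType d) (R : realType)
    (P : probability T R) (X : nat -> {mfun T >-> R}) (n : nat)
    (lam : nat -> R) (t : R) :
  (0 < n)%N -> 0 <= t ->
  (forall i, (i < n)%N -> 0 < lam i) ->
  (forall i j, (i < n)%N -> (j < n)%N -> i != j -> lam i != lam j) ->
  (forall i, (i < n)%N -> exponential_rv (lam i) (X i : {RV P >-> R})) ->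
  (forall A : nat -> set R, (forall i, measurable (A i)) ->
    P (\big[setI/setT]_(0 <= i < n) (X i @^-1` A i)) =
    (\prod_(0 <= i < n) P (X i @^-1` A i))%E) ->
  P [set x | \sum_(0 <= i < n) X i x <= t] =
  (\sum_(0 <= i < n) outage_coef n lam i * (1 - expR (- (t / lam i))))%:E.
Proof.
move=> n0 t0 lam0 laminj Xexp Xindep.
pose S m : {mfun T >-> R} := \sum_(0 <= i < m) X i.
have SE m x : S m x = \sum_(0 <= i < m) X i x by rewrite /S mfun_sum.
(* The closed formula holds only for [0 <= u]; the value 0 below makes [G m] the distribution
   function on the whole line, as the convolution lemma requires. *)
pose G m u : R := if 0 <= u then
  \sum_(0 <= i < m) outage_coef m lam i * (1 - expR (- (u / lam i))) else 0.
suff SG m u : (0 < m <= n)%N -> P [set x | S m x <= u] = (G m u)%:E.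
  have := SG n t; rewrite n0 leqnn /G t0 => <- //.
  by congr (P _); apply/seteqP; split => x /=; rewrite SE.
(* The base case is one summand, where C_0 is an empty product and the formula is the complement of
   the exponential tail. *)
elim: m u => // -[_ u _ | m IHm u /andP[_ ltmn]].
  have mX : measurable [set x | u < X 0%N x].
    rewrite (_ : [set x | _] = X 0%N @^-1` `]u, +oo[%classic).
      exact: measurable_funPTI.
    by apply/seteqP; split => x /=; rewrite in_itv/= andbT.
  rewrite (_ : [set x | _] = ~` [set x | u < X 0%N x]); last first.
    by apply/seteqP; split => x /=; rewrite SE big_nat1 leNgt => /negP.
  rewrite probability_setC//.
  have := Xexp _ n0; rewrite exponential_rvP ?lam0// => ->.
  rewrite -EFinB; congr EFin.
  rewrite /G big_nat1 /outage_coef big_mkcond big_nat1 mul1r.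
  case: ifPn => u0; first by rewrite (max_idPr u0) mulrC.
  by rewrite max_l ?mulr0 ?oppr0 ?expR0 ?subrr// ltW// ltNge.
transitivity (P [set x | S m.+1 x + X m.+1 x <= u]).
  have SS x : S m.+2 x = S m.+1 x + X m.+1 x by rewrite !SE [LHS]big_nat_recr.
  by congr (P _); apply/seteqP; split => x /=; rewrite SS.
rewrite (@probability_le_add_exponential _ _ _ P (S m.+1) (X m.+1) (G m.+1)
  (lam m.+1)).
- rewrite {2}/G; case: ifPn => [u0|u0]; last first.
    by rewrite set_itv_ge ?integral_set0// bnd_simp.
  rewrite -integral_hypoexponential_step//; last first.
    by move=> i j lti ltj; apply: laminj; exact: leq_trans ltmn.
  apply: eq_integral => y; rewrite inE/= in_itv/= => /andP[y0 yu].
  by rewrite /G subr_ge0 yu.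
- exact: lam0.
- exact: Xexp.
- by move=> A C mA mC; exact: (partial_sum_indep_next Xindep).
- by move=> v; apply: IHm; rewrite /= ltnW.
- by move=> v v0; rewrite /G leNgt v0.
Qed.

(** * From channel gains to independent exponential summands *)

Lemma exponential_rv_scale d (T : measurableType d) (R : realType)
    (P : probability T R) (Y : {RV P >-> R}) (m c : R) :
  0 < m -> 0 < c -> exponential_rv m Y ->
  exponential_rv (m * c) (scale_mfun c Y : {RV P >-> R}).
Proof.
move=> m0 c0 /(exponential_rvP _ m0) Yexp; apply/exponential_rvP.
  exact: mulr_gt0.
move=> t; rewrite [X in P X](_ : _ = [set x | t / c < Y x]); last first.
  by apply/seteqP; split => x /=; rewrite ltr_pdivrMr.
rewrite Yexp; congr (expR (- _))%:E.
rewrite invfM -mulrA; congr (_ * _).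
by rewrite maxr_pMr ?invr_ge0 ?ltW// mulr0 mulrC.
Qed.

Lemma mutually_independent_seq d (T : measurableType d) (R : realType)
    (P : probability T R) (I : choiceType) (D : set I) (X : I -> {RV P >-> R})
    (s : seq I) (A : I -> set R) :
  mutually_independent D X -> uniq s -> [set` s] `<=` D ->
  (forall i, measurable (A i)) ->
  P (\big[setI/setT]_(i <- s) (X i @^-1` A i)) =
  (\prod_(i <- s) P (X i @^-1` A i))%E.
Proof.
move=> Xindep us sD mA.
have perm_s : perm_eq (seq_fset tt s) s.
  by rewrite -[X in perm_eq _ X]undup_id// seq_fset_perm.
rewrite -!(perm_big _ perm_s) -(bigcap_fset _ (seq_fset tt s)).
apply: Xindep => // i.
by rewrite /mkset seq_fsetE => si; exact: sD.
Qed.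

Lemma lt_bigmin_seq (R : realType) (I : eqType) (s : seq I)
    (F : I -> R) (x0 t : R) :
  (t < \big[Order.min/x0]_(i <- s) F i) = (t < x0) && all (fun i => t < F i) s.
Proof.
elim: s => [|i s IHs]; first by rewrite big_nil andbT.
by rewrite big_cons lt_min IHs/= andbCA.
Qed.

(** All [K] variables must exceed the threshold, so the tails multiply and the rates add up to K /
    m. *)
Lemma exponential_rv_min d (T : measurableType d) (R : realType)
    (P : probability T R) (K : nat) (m : R) (h : nat -> {RV P >-> R})
    (h1 : {RV P >-> R}) :
  (0 < K)%N -> 0 < m ->
  (forall k, (1 <= k <= K)%N -> exponential_rv m (h k)) ->
  mutually_independent [set k | (1 <= k <= K)%N] h ->
  (forall x, h1 x = \big[Order.min/h 1%N x]_(1 <= k < K.+1) h k x) ->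
  exponential_rv (m / K%:R) h1.
Proof.
move=> K0 m0 hexp hindep h1E; apply/exponential_rvP.
  by rewrite divr_gt0// ltr0n.
move=> t.
have sD : [set` index_iota 1 K.+1] `<=` [set k | (1 <= k <= K)%N].
  by move=> k /=; rewrite mem_index_iota.
rewrite (_ : [set x | _] =
  \big[setI/setT]_(1 <= k < K.+1) (h k @^-1` `]t, +oo[%classic)).
  rewrite (mutually_independent_seq hindep (iota_uniq _ _) sD)//.
  rewrite (eq_big_nat _ _
    (F2 := fun=> (expR (- (m^-1 * Num.max 0 t)))%:E)); last first.
    move=> k /hexp/(exponential_rvP _ m0) <-.
    by congr (P _); apply/seteqP; split => x /=; rewrite in_itv/= andbT.
  rewrite prodEFin big_const_nat iter_mulr_1 subn1/= -expRM_natl.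
  by congr (expR _)%:E; rewrite invfM invrK mulrN mulrA (mulrC K%:R).
rewrite big_nat -bigcap_seq_cond.
apply/seteqP; split => x /=; rewrite h1E lt_bigmin_seq.
  move=> /andP[_ /allP tx] k /= /andP[kin _].
  by rewrite in_itv/= andbT tx.
move=> tx; have tx' k : (1 <= k < K.+1)%N -> t < h k x.
  move=> kin; have := tx k; rewrite /= mem_index_iota kin => /(_ isT).
  by rewrite in_itv/= andbT.
(* The default element [h 1] of the minimum contributes an extra condition, which is the case
   [k = 1]. *)
rewrite tx'//; apply/allP => k; rewrite mem_index_iota; exact: tx'.
Qed.

Lemma independent_of_family_seq d (T : measurableType d) (R : realType)
    (P : probability T R) (I : choiceType) (D : set I) (X : {RV P >-> R})
    (Y : I -> {RV P >-> R}) (s : seq I) (A : set R) (B : I -> set R) :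
  independent_of_family X D Y -> mutually_independent D Y ->
  uniq s -> [set` s] `<=` D -> measurable A -> (forall i, measurable (B i)) ->
  P (X @^-1` A `&` \big[setI/setT]_(i <- s) (Y i @^-1` B i)) =
  (P (X @^-1` A) * \prod_(i <- s) P (Y i @^-1` B i))%E.
Proof.
move=> XY Yindep us sD mA mB.
rewrite -(mutually_independent_seq Yindep us sD mB); apply: XY => //.
(* A finite intersection of generating events belongs to the sigma-algebra over which [XY]
   quantifies. *)
set G := (X in <<s X >>).
suff : @measurable _ (g_sigma_algebraType G)
  (\big[setI/setT]_(i <- s) (Y i @^-1` B i)) by [].
rewrite big_seq; apply: bigsetI_measurable => i si.
apply: sub_sigma_algebra; exists i; first exact: sD.
by exists (B i); first exact: mB.
Qed.

Theorem mainTheorem3 (d : measure_display) (T : measurableType d)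
    (R : realType) (P : probability T R)
    (K : nat) (hK : (2 <= K)%N)
    (h : nat -> {RV P >-> R}) (h1 : {RV P >-> R}) (g : nat -> {RV P >-> R})
    (h_exp : forall k, (1 <= k <= K)%N -> exponential_rv 1 (h k))
    (h_indep : mutually_independent [set k | (1 <= k <= K)%N] h)
    (h1_min : forall x, h1 x = \big[Order.min/h 1%N x]_(1 <= k < K.+1) h k x)
    (g_exp : forall j, (2 <= j <= K)%N -> exponential_rv 1 (g j))
    (g_indep : mutually_independent [set j | (2 <= j <= K)%N] g)
    (h1_g_indep : independent_of_family h1 [set j | (2 <= j <= K)%N] g)
    (rho p1 : R) (q : nat -> R)
    (hrho : 0 < rho) (hp1 : 0 < p1)
    (hq : forall j, (2 <= j <= K)%N -> 0 < q j)
    (lam_distinct : forall i j, (i < K)%N -> (j < K)%N -> i != j ->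
       lambda K rho p1 q i != lambda K rho p1 q j)
    (phi1 : R) (hphi1 : 0 <= phi1) :
  P [set x | weakest_snr K rho p1 q h1 g x <= phi1] =
  (\sum_(0 <= i < K) outage_coef K (lambda K rho p1 q) i *
     (1 - expR (- (phi1 / lambda K rho p1 q i))))%:E.
Proof.
have K0 : (0 < K)%N by exact: ltnW.
(* The summands are [c i] times [Y i], where [Y 0] has mean 1 / K as a minimum and the others mean
   1; this gives exactly the means lambda_i. *)
pose Y i : {RV P >-> R} := if i == 0%N then h1 else g (K - i + 1)%N.
pose c i := if i == 0%N then rho * p1 ^+ 2 else rho * q (K - i + 1)%N ^+ 2.
pose X i : {mfun T >-> R} := scale_mfun (c i) (Y i).
have Kin i : (0 < i < K)%N -> (2 <= K - i + 1 <= K)%N by lia.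
have c0 i : (i < K)%N -> 0 < c i.
  rewrite /c; case: i => [|i] ltiK; rewrite /= mulr_gt0 ?exprn_gt0//.
  exact/hq/Kin.
have lamE i : lambda K rho p1 q i = (if i == 0%N then 1 / K%:R else 1) * c i.
  by rewrite /lambda /c; case: i => [|i]/=; rewrite mul1r// mulrC.
have Xexp i : (i < K)%N ->
    exponential_rv (lambda K rho p1 q i) (X i : {RV P >-> R}).
  move=> ltiK; rewrite lamE; apply: exponential_rv_scale; last 2 first.
  - exact: c0.
  - rewrite /Y; case: i ltiK => [|i] ltiK /=; last exact/g_exp/Kin.
    exact: (exponential_rv_min K0 ltr01 h_exp h_indep h1_min).
  - by case: ifP => // _; rewrite divr_gt0// ltr0n.
rewrite -(sum_exponential_cdf K0 hphi1 _ lam_distinct Xexp).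
- congr (P _); apply/funext => x /=; rewrite big_ltn//=.
  congr ((_ <= _) = true).
  rewrite /weakest_snr mulr_sumr; congr (_ + _).
    by rewrite /c /=; ring.
  apply: eq_big_nat => i /andP[]; rewrite lt0n => /negPf i0 _.
  by rewrite /c /Y i0 mulrCA.
- move=> i ltiK; rewrite lamE mulr_gt0 ?c0//.
  by case: ifP => // _; rewrite divr_gt0// ltr0n.
move=> A mA; rewrite !(big_ltn K0).
(* [B i] is the condition on the unscaled gain [Y i] that amounts to [X i] lying in [A i]. *)
pose B i : set R := (fun y : R => y * c i) @^-1` A i.
have mB i : measurable (B i).
  rewrite -[X in measurable X]setTI.
  have : measurable_fun setT (fun y : R => y * c i) by exact: measurable_funM.
  by apply.
pose s := [seq (K - i + 1)%N | i <- index_iota 1 K].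
have us : uniq s.
  rewrite map_inj_in_uniq ?iota_uniq// => i j; rewrite !mem_index_iota; lia.
have sD : [set` s] `<=` [set j | (2 <= j <= K)%N].
  by move=> j /= /mapP[i]; rewrite mem_index_iota => ? ->; exact: Kin.
have := independent_of_family_seq h1_g_indep g_indep us sD (mB 0%N)
  (fun j => mB (K - j + 1)%N).
(* For 1 <= i < K the reindexing i -> K - i + 1 undoes itself despite truncated subtraction, so
   conditions indexed by user return to the order of the summands. *)
have BE i : (1 <= i < K)%N ->
    g (K - i + 1)%N @^-1` B (K - (K - i + 1) + 1)%N = X i @^-1` A i.
  move=> iK; rewrite (_ : (K - (K - i + 1) + 1)%N = i); last by lia.
  by rewrite /B /X /Y; case: i iK.
rewrite !big_map (eq_big_nat _ _ BE).
rewrite (eq_big_nat _ _ (F2 := fun i => P (X i @^-1` A i))) => [//|i /BE -> //].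
Qed.
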